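(* Let $n\ge 2$ be an integer, let $R_{A_n}=\mathbb{C}[s,st,st^2,\dots,st^n]$, and let $J=\langle st,st^2,\dots,st^{n-1}\rangle\subset R_{A_n}$. Put $h_1=\theta_2$ and $h_2=n\theta_1-\theta_2$. Then $\mathbb{I}(J)$ and $D(R_{A_n},J)$ are $\mathbb{Z}^2$-graded, and for $d=(d_1,d_2)\in\mathbb{Z}^2$ their graded pieces are $$\mathbb{I}(J)_{d}=\begin{cases} s^{d_1}t^{d_2}\cdot\mathbb{C}[\theta] & \text{if } d\in\mathbb{N}A_n,\\ s^{d_1}t^{d_2}\cdot\langle (h_1,-d_2)!\rangle & \text{if } d\in \mathbf{C4},\\ s^{d_1}t^{d_2}\cdot\langle (h_2,-nd_1+d_2)!\rangle & \text{if } d\in \mathbf{C2},\\ s^{d_1}t^{d_2}\cdot\langle (h_1,-d_2)!\,(h_2,-nd_1+d_2)!\rangle & \text{if } d\in \mathbf{C3}, \end{cases}$$ $$D(R_{A_n},J)_{d}=\begin{cases} s^{d_1}t^{d_2}\cdot\mathbb{C}[\theta] & \text{if } s^{d_1}t^{d_2}\in J,\\ s^{d_1}t^{d_2}\cdot\langle (h_1,-d_2)!\rangle & \text{if } d\in(\mathbf{C4}\setminus(-\sigma_2))\cup(\sigma_1\setminus\{0\}),\\ s^{d_1}t^{d_2}\cdot\langle (h_2,-nd_1+d_2)!\rangle & \text{if } d\in(\mathbf{C2}\setminus(-\sigma_1))\cup(\sigma_2\setminus\{0\}),\\ s^{d_1}t^{d_2}\cdot\langle (h_1,-d_2)!\,(h_2,-nd_1+d_2)!\rangle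 & \text{if } d\in\mathbf{C3}\cup(-\sigma_1)\cup(-\sigma_2). \end{cases}$$ Consequently, $$\left(\frac{\mathbb{I}(J)}{D(R_{A_n},J)}\right)_{d}=\begin{cases} 0 & \text{if } d\in\mathbb{Z}^2\setminus(\mathbb{Z}\sigma_1\cup\mathbb{Z}\sigma_2),\\[2pt] \dfrac{\mathbb{C}[\theta]}{\langle h_1h_2\rangle} & \text{if } d=0,\\[8pt] s^{d_1}\cdot\dfrac{\langle (h_2,-nd_1)!\rangle}{\langle h_1\,(h_2,-nd_1)!\rangle} & \text{if } d\in\mathbb{Z}\sigma_1\setminus\{0\},\\[8pt] s^{d_1}t^{d_2}\cdot\dfrac{\langle (h_1,-d_2)!\rangle}{\langle h_2\,(h_1,-d_2)!\rangle} & \text{if } d\in\mathbb{Z}\sigma_2\setminus\{0\}. \end{cases}$$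
   Context: For a finitely generated commutative $\mathbb{C}$-algebra $R$, $D(R)$ is the ring of ($\mathbb{C}$-linear, Grothendieck) differential operators on $R$, and $\delta\ast f$ is the action of $\delta\in D(R)$ on $f\in R$. For an ideal $J$ of $R$, $\mathbb{I}(J):=\{\delta\in D(R)\mid\delta\ast J\subseteq J\}$ is the idealizer of $J$, and $D(R,J):=\{\delta\in D(R)\mid\delta\ast R\subseteq J\}$, which is a two-sided ideal of $\mathbb{I}(J)$. The ring $R_{A_n}=\mathbb{C}[s,st,\dots,st^n]\subset\mathbb{C}[s^{\pm1},t^{\pm1}]$ is the semigroup ring of $\mathbb{N}A_n$, the semigroup in $\mathbb{Z}^2$ generated by $(1,0),(1,1),\dots,(1,n)$; the point $(a,b)$ corresponds to the monomial $s^at^b$. $D(R_{A_n})$ is identified with the subring $\{\delta\mid\delta\ast R_{A_n}\subseteq R_{A_n}\}$ of the ring $D(\mathbb{C}[s^{\pm1},t^{\pm1}])$, which is generated by $s^{\pm1},t^{\pm1},\partial_1=\partial/\partial s,\partial_2=\partial/\partial t$ and is $\mathbb{Z}^2$-graded by $\deg s=(1,0)=-\deg\partial_1$, $\deg t=(0,1)=-\deg\partial_2$. Set $\theta_1=s\partial_1$, $\theta_2=t\partial_2$, and $\mathbb{C}[\theta]=\mathbb{C}[\theta_1,\theta_2]$, a commutative polynomial ring of operators of degree $0$; $f(\theta)\ast s^{m_1}t^{m_2}=f(m_1,m_2)s^{m_1}t^{m_2}$. The degree-$d$ piece of $D(\mathbb{C}[s^{\pm1},t^{\pm1}])$ is $s^{d_1}t^{d_2}\cdot\mathbb{C}[\theta]$.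 Angle brackets $\langle\cdot\rangle$ after $s^{d_1}t^{d_2}\cdot$ denote ideals of $\mathbb{C}[\theta]$, and $s^{d_1}t^{d_2}\cdot\frac{I}{I'}$ denotes $(s^{d_1}t^{d_2}\cdot I)/(s^{d_1}t^{d_2}\cdot I')$ for ideals $I'\subseteq I$ of $\mathbb{C}[\theta]$. Descending factorial: for an integer $m\ge0$, $(\alpha,m)!:=\prod_{i=0}^{m}(\alpha-i)$, and $(\alpha,m)!:=1$ for $m<0$. Facets: $\sigma_1=\{(x,0)\mid x\in\mathbb{Z}_{\ge0}\}$ and $\sigma_2=\{(x,nx)\mid x\in\mathbb{Z}_{\ge0}\}$; $-\sigma_i$ is the set of negatives of elements of $\sigma_i$ (it contains $0$), and $\mathbb{Z}\sigma_i$ is the subgroup generated by $\sigma_i$. Writing $h_1(d)=d_2$ and $h_2(d)=nd_1-d_2$ for $d\in\mathbb{Z}^2$, the chambers are $\mathbf{C2}=\{d\in\mathbb{Z}^2\mid h_1(d)\ge0,\ h_2(d)<0\}$, $\mathbf{C3}=\{d\in\mathbb{Z}^2\mid h_1(d)<0,\ h_2(d)<0\}$, $\mathbf{C4}=\{d\in\mathbb{Z}^2\mid h_1(d)<0,\ h_2(d)\ge0\}$. *)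

(* Defs.v *)
From HB Require Import structures.
From mathcomp Require Import all_boot all_order all_algebra.
From mathcomp Require Import finmap.
From mathcomp Require Import boolp classical_sets functions reals.
From mathcomp Require Import complex.
(* monalg and mpoly declare clashing notations for {mpoly R[n]}; only those of
   mpoly are wanted, monalg is used for the finitely supported functions. *)
From mathcomp Require Import -(notations) monalg.
From mathcomp Require Import mpoly.

Set Implicit Arguments.
Unset Strict Implicit.
Unset Printing Implicit Defensive.

Import Order.TTheory GRing.Theory Num.Theory.
Local Open Scope classical_set_scope.
Local Open Scope ring_scope.

Definition CC (R : realType) : numClosedFieldType := R[i].

Definition Z2 : Type := (int * int)%type.
HB.instance Definition _ := GRing.Zmodule.on Z2.

(* The Laurent polynomial ring K[s^{+-1},t^{+-1}], as the group algebra of Z^2.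
   monalg only gives a ring structure to {malg K[M]} when the monoid M has no
   nontrivial unit, so for M = Z^2 the (convolution) product is built here on
   top of monalg's K-module of finitely supported functions Z^2 -> K. *)
Definition laurent (K : comNzRingType) : Type := monalg.malg Z2 K.

Section LaurentRing.
Variable K : comNzRingType.
Local Notation L := (laurent K).
Local Notation "<< z *g k >>" := (monalg.mkmalgU k z).

HB.instance Definition _ := GRing.Lmodule.on L.

Local Notation term a b k1 k2 :=
  (<< monalg.mcoeff k1 a * monalg.mcoeff k2 b *g (k1 + k2 : Z2) >>).

Definition lmul (a b : L) : L :=
  \sum_(k1 <- monalg.msupp a) \sum_(k2 <- monalg.msupp b) term a b k1 k2.

Lemma lmulw (d1 d2 : {fset Z2}) (a b : L) :
  (monalg.msupp a `<=` d1)%fset -> (monalg.msupp b `<=` d2)%fset ->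
  lmul a b = \sum_(k1 <- d1) \sum_(k2 <- d2) term a b k1 k2.
Proof.
move=> le1 le2; rewrite /lmul (big_fset_incl _ le1) /=.
  apply/eq_bigr=> k1 _; apply/big_fset_incl => // k _ /mcoeff_outdom ->.
  by rewrite mulr0 monalgU0.
move=> k _ /mcoeff_outdom ak.
by rewrite big1 => // k' _; rewrite ak mul0r monalgU0.
Qed.

Lemma lmulC : commutative lmul.
Proof.
move=> a b; rewrite /lmul exchange_big /=.
by apply/eq_bigr=> k1 _; apply/eq_bigr=> k2 _; rewrite mulrC addrC.
Qed.

Lemma lmulUU (c1 c2 : K) (k1 k2 : Z2) :
  lmul << c1 *g k1 >> << c2 *g k2 >> = << c1 * c2 *g k1 + k2 >>.
Proof.
by rewrite (lmulw monalg.msuppU_le monalg.msuppU_le) !big_seq_fset1 !mcoeffUU.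
Qed.

Lemma lmulDl : left_distributive lmul +%R.
Proof.
move=> a b c.
rewrite [in RHS](lmulw (fsubsetUl _ (monalg.msupp b)) (fsubset_refl _)).
rewrite [in RHS](lmulw (fsubsetUr (monalg.msupp a) _) (fsubset_refl _)).
rewrite (lmulw (monalg.msuppD_le _ _) (fsubset_refl _)).
rewrite -big_split /=; apply/eq_bigr=> k1 _.
rewrite -big_split /=; apply/eq_bigr=> k2 _.
by rewrite monalg.mcoeffD mulrDl monalgUD.
Qed.

Lemma lmulDr : right_distributive lmul +%R.
Proof. by move=> a b c; rewrite lmulC lmulDl ![lmul _ a]lmulC. Qed.

Lemma lmul0 : left_zero 0 lmul.
Proof. by move=> a; rewrite /lmul monalg.msupp0 big_seq_fset0. Qed.

Lemma lmulr0 : right_zero 0 lmul.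
Proof. by move=> a; rewrite lmulC lmul0. Qed.

Lemma lmul_suml (I : Type) (r : seq I) (F : I -> L) (b : L) :
  lmul (\sum_(i <- r) F i) b = \sum_(i <- r) lmul (F i) b.
Proof. exact: (big_morph (lmul^~ b) (fun x y => lmulDl x y b) (lmul0 b)). Qed.

Lemma lmul_sumr (I : Type) (r : seq I) (F : I -> L) (a : L) :
  lmul a (\sum_(i <- r) F i) = \sum_(i <- r) lmul a (F i).
Proof. exact: (big_morph (lmul a) (lmulDr a) (lmulr0 a)). Qed.

Lemma lmulA : associative lmul.
Proof.
move=> a b c; rewrite [a]monalgE (lmul_suml _ _ (lmul b c)) (lmul_suml _ _ b).
rewrite (lmul_suml _ _ c); apply: eq_bigr => i _; set x := << _ *g i >>.
rewrite [b]monalgE (lmul_suml _ _ c) !(lmul_sumr _ _ x) (lmul_suml _ _ c).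
apply: eq_bigr => j _; set y := << _ *g j >>.
rewrite [c]monalgE (lmul_sumr _ _ y) (lmul_sumr _ _ x) (lmul_sumr _ _ (lmul x y)).
by apply: eq_bigr => k _; rewrite !lmulUU mulrA addrA.
Qed.

Definition lone : L := << 1 *g (0 : Z2) >>.

Lemma lmul1 : left_id lone lmul.
Proof.
move=> a; rewrite [a in LHS]monalgE lmul_sumr [RHS]monalgE.
by apply/eq_bigr=> k _; rewrite lmulUU mul1r add0r.
Qed.

Lemma lone_neq0 : lone != 0.
Proof. by rewrite monalgU_eq0 oner_eq0. Qed.

HB.instance Definition _ :=
  GRing.Zmodule_isComNzRing.Build L lmulA lmulC lmul1 lmulDl lone_neq0.

Lemma lscaleAl (c : K) (a b : L) : c *: (a * b) = (c *: a) * b.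
Proof.
have scaleU (x : K) k : c *: (<< x *g k >> : L) = << c * x *g k >>.
  by apply/monalg.malgP=> k'; rewrite monalg.mcoeffZ !monalg.mcoeffU mulrnAr.
change (c *: lmul a b = lmul (c *: a) b).
rewrite [a]monalgE lmul_suml !scaler_sumr lmul_suml; apply: eq_bigr => i _.
rewrite [b]monalgE !lmul_sumr scaler_sumr; apply: eq_bigr => j _.
by rewrite scaleU !lmulUU scaleU mulrA.
Qed.

HB.instance Definition _ := GRing.Lmodule_isLalgebra.Build K L lscaleAl.
HB.instance Definition _ := GRing.Lalgebra_isComAlgebra.Build K L.

(* s^{m_1} t^{m_2} *)
Definition mon (m : Z2) : L := << 1 *g m >>.

Lemma monM (m m' : Z2) : mon m * mon m' = mon (m + m').
Proof. by rewrite [LHS]lmulUU mulr1. Qed.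

Lemma mon0 : mon 0 = 1.
Proof. by []. Qed.

End LaurentRing.

Section DifferentialOperators.
Variables (K : comNzRingType) (A : comAlgType K).

(* Grothendieck's filtration: diffop_lt k is the set of K-linear operators of
   order < k, i.e. those delta whose commutators [delta, a] with all the
   multiplications by elements a of A have order < k - 1. *)
Fixpoint diffop_lt (k : nat) : set (A -> A) :=
  if k is k'.+1 then
    [set delta | linear delta /\
      forall a, diffop_lt k' (fun f => delta (a * f) - a * delta f)]
  else [set 0].

Definition diffop : set (A -> A) := [set delta | exists k, diffop_lt k delta].

(* In the next three definitions S is a subring of A and I an ideal of S; the
   ring D(S) is identified with the stabilizer of S in D(A), which is the usual
   identification when S is a domain and A a localization of S. *)
Definition diffop_sub (S : set A) : set (A -> A) :=
  [set delta | diffop delta /\ forall f, S f -> S (delta f)].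

Definition idealizer (S I : set A) : set (A -> A) :=
  [set delta | diffop_sub S delta /\ forall f, I f -> I (delta f)].

Definition diffop_into (S I : set A) : set (A -> A) :=
  [set delta | diffop_sub S delta /\ forall f, S f -> I (delta f)].

End DifferentialOperators.

Section LaurentOperators.
Variable K : comNzRingType.
Local Notation L := (laurent K).
Local Notation CT := {mpoly K[2]}.

Definition pd1 (f : L) : L :=
  \sum_(m <- monalg.msupp f)
     (m.1%:~R * monalg.mcoeff m f) *: mon K (m - (1, 0)).

Definition pd2 (f : L) : L :=
  \sum_(m <- monalg.msupp f)
     (m.2%:~R * monalg.mcoeff m f) *: mon K (m - (0, 1)).

Definition theta1 (f : L) : L := mon K (1, 0) * pd1 f.
Definition theta2 (f : L) : L := mon K (0, 1) * pd2 f.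

(* K[theta] is {mpoly K[2]}, theta_1 and theta_2 being the two variables;
   op_of_poly p is p(theta_1, theta_2) as an operator on Laurent polynomials. *)
Definition op_of_poly (p : CT) : L -> L := fun f =>
  \sum_(m <- mpoly.msupp p)
     mpoly.mcoeff m p *:
       iter (m (ord0 : 'I_2)) theta1 (iter (m (ord_max : 'I_2)) theta2 f).

(* s^{d_1} t^{d_2} . I, for a set I of elements of K[theta] *)
Definition shift (d : Z2) (I : set CT) : set (L -> L) :=
  [set delta | exists2 p, I p & delta = fun f => mon K d * op_of_poly p f].

(* the elements of degree d of a set M of operators *)
Definition piece (M : set (L -> L)) (d : Z2) : set (L -> L) :=
  M `&` shift d [set: CT].

Definition homogeneous_decomposition
    (M : set (L -> L)) (delta : L -> L) (c : Z2 -> L -> L) : Prop :=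
  (forall d, piece M d (c d)) /\
  (exists D : seq Z2,
     [/\ uniq D, forall d, d \notin D -> c d = 0 & delta = \sum_(d <- D) c d]).

(* M is the direct sum of its homogeneous pieces *)
Definition Z2graded (M : set (L -> L)) : Prop :=
  forall delta, M delta <-> exists! c, homogeneous_decomposition M delta c.

(* M / N as a set of cosets; its zero is the coset N *)
Definition quotient (M N : set (L -> L)) : set (set (L -> L)) :=
  [set X | exists2 delta, M delta & X = [set delta + nu | nu in N]].

(* the degree d piece of the graded quotient M / N *)
Definition quotient_piece (M N : set (L -> L)) (d : Z2) : set (set (L -> L)) :=
  quotient (piece M d) (piece N d).

Definition pideal (g : CT) : set CT := [set p * g | p in [set: CT]].

Definition desc_fact (a : CT) (m : int) : CT :=
  if m is Posz k then \prod_(i < k.+1) (a - (i : nat)%:R) else 1.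

Definition h1 : CT := 'X_(ord_max : 'I_2).
Definition h2 (n : nat) : CT := 'X_(ord0 : 'I_2) *+ n - 'X_(ord_max : 'I_2).

(* K[s, st, ..., st^n] *)
Definition RA (n : nat) : set L :=
  [set f | exists p : {mpoly K[n.+1]},
     f = mpoly.mmap (fun c : K => c%:A) (fun i => mon K (1, (i : nat)%:Z)) p].

(* the ideal of RA n generated by st, ..., st^{n-1} *)
Definition J (n : nat) : set L :=
  [set f | exists2 r : nat -> L, forall i, RA n (r i) &
     f = \sum_(1 <= i < n) r i * mon K (1, i%:Z)].

Definition IJ (n : nat) : set (L -> L) := idealizer (RA n) (J n).
Definition DJ (n : nat) : set (L -> L) := diffop_into (RA n) (J n).

End LaurentOperators.

Definition NA (n : nat) : set Z2 :=
  [set d | exists c : 'I_n.+1 -> nat,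
     d = \sum_(i < n.+1) ((1, (i : nat)%:Z) : Z2) *+ c i].

Definition sigma1 : set Z2 := [set d | exists x : nat, d = (x%:Z, 0)].
Definition sigma2 (n : nat) : set Z2 :=
  [set d | exists x : nat, d = (x%:Z, n%:Z * x%:Z)].

Definition opp_set (A : set Z2) : set Z2 := [set - d | d in A].

(* the subgroup of Z^2 generated by A *)
Definition Zspan (A : set Z2) : set Z2 :=
  smallest [set H : set Z2 | H 0 /\ forall x y, H x -> H y -> H (x - y)] A.

Definition C2 (n : nat) : set Z2 := [set d | 0 <= d.2 /\ n%:Z * d.1 - d.2 < 0].
Definition C3 (n : nat) : set Z2 := [set d | d.2 < 0 /\ n%:Z * d.1 - d.2 < 0].
Definition C4 (n : nat) : set Z2 := [set d | d.2 < 0 /\ 0 <= n%:Z * d.1 - d.2].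

Arguments h1 {K}.
Arguments h2 {K}.
Arguments op_of_poly {K}.
Arguments pideal {K}.
Arguments desc_fact {K}.
Arguments RA K n : clear implicits.
Arguments J K n : clear implicits.
Arguments IJ K n : clear implicits.
Arguments DJ K n : clear implicits.

(* Main.v *)
Require Import Defs.
From HB Require Import structures.
From mathcomp Require Import all_boot all_order all_algebra.
From mathcomp Require Import finmap ring zify.
From mathcomp Require Import boolp classical_sets functions reals complex.
From mathcomp Require Import mpoly.
From mathcomp Require monalg.

(** A differential operator of the Laurent ring is determined by the function
    m |-> s^-m (delta * s^m), where s^m denotes the monomial of exponent m.
    Commuting delta with multiplications by monomials turns into taking finite
    differences of this function, so delta has order < k if and only if all k-th
    differences vanish. Newton interpolation then writes every differential
    operator as a finite sum of operators s^d p_d(theta), which act by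
    s^m |-> p_d(m) s^(m+d). Both R_A and J consist of the Laurent polynomials
    with support in a set of lattice points, the cone h_1, h_2 >= 0 and its
    interior respectively; hence the idealizer and D(R_A, J) are cut out by
    conditions p_d(m) = 0 for the m such that m and m + d violate the inclusions.
    Both are therefore graded, and in degree d these m are Zariski dense in a
    union of lines h_i = j, so that p_d is divisible by the product of the
    linear forms h_i - j. *)

Set Implicit Arguments.
Unset Strict Implicit.
Unset Printing Implicit Defensive.

Import Order.TTheory GRing.Theory Num.Theory.
Local Open Scope classical_set_scope.
Local Open Scope ring_scope.

(** * Coefficients of Laurent polynomials *)

Section Coefficients.
Variable K : comNzRingType.
Local Notation L := (laurent K).

Definition coef (e : Z2) (f : L) : K := monalg.mcoeff e f.

Lemma coefP (f g : L) : (forall e, coef e f = coef e g) -> f = g.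
Proof. by move=> fg; apply/monalg.malgP. Qed.

Lemma coef0 e : coef e 0 = 0.
Proof. exact: monalg.mcoeff0. Qed.

Lemma coefD e f g : coef e (f + g) = coef e f + coef e g.
Proof. exact: monalg.mcoeffD. Qed.

Lemma coefZ e (a : K) f : coef e (a *: f) = a * coef e f.
Proof. exact: monalg.mcoeffZ. Qed.

Lemma coef_sum (I : Type) (r : seq I) (P : pred I) (F : I -> L) e :
  coef e (\sum_(i <- r | P i) F i) = \sum_(i <- r | P i) coef e (F i).
Proof. exact: (big_morph (coef e) (coefD e) (coef0 e)). Qed.

Lemma coef_mon e d : coef e (mon K d) = (d == e)%:R.
Proof. exact: monalg.mcoeffU. Qed.

Definition supp (f : L) : seq Z2 := monalg.msupp f.

Lemma uniq_supp f : uniq (supp f).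
Proof. exact: fset_uniq. Qed.

Lemma mem_supp f e : (e \in supp f) = (coef e f != 0).
Proof. by rewrite /coef /supp monalg.mcoeff_neq0. Qed.

Lemma laurentE f : f = \sum_(m <- supp f) coef m f *: mon K m.
Proof.
rewrite [LHS]monalg.monalgE; apply: eq_bigr => m _; apply: coefP => e.
by rewrite coefZ coef_mon [LHS]monalg.mcoeffU mulr_natr.
Qed.

(** When [e] lies outside the support no index matches it, and the hypothesis makes the right-hand
    side 0 as well. *)
Lemma sum_supp_delta f e (F : Z2 -> K) :
  (coef e f = 0 -> F e = 0) ->
  \sum_(m <- supp f) F m * (m == e)%:R = F e.
Proof.
move=> Fe; have [ef|ef] := boolP (e \in supp f).
  rewrite (bigD1_seq e) ?uniq_supp //= eqxx mulr1 big1 ?addr0 // => m /negPf ->.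
  by rewrite mulr0.
rewrite big1_seq => [|m /= mf]; first by rewrite Fe //; move: ef; rewrite mem_supp negbK => /eqP.
by have [me|] := eqVneq m e; [rewrite -me mf in ef|rewrite mulr0].
Qed.

Lemma coef_monM e d f : coef e (mon K d * f) = coef (e - d) f.
Proof.
rewrite {1}(laurentE f) mulr_sumr coef_sum.
rewrite (eq_bigr (fun m => coef m f * (m == e - d)%:R)) => [|m _].
  by rewrite (sum_supp_delta (F := coef^~ f)).
by rewrite -scalerAr coefZ monM coef_mon addrC -[in LHS](subrK d e) (inj_eq (addIr d)).
Qed.

Lemma coef_theta1 e f : coef e (theta1 f) = e.1%:~R * coef e f.
Proof.
rewrite /theta1 coef_monM /pd1 coef_sum.
rewrite (eq_bigr (fun m : Z2 => (m.1%:~R * coef m f) * (m == e)%:R)) => [|m _].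
  by rewrite (sum_supp_delta (F := fun m : Z2 => m.1%:~R * coef m f)) // => ->; rewrite mulr0.
by rewrite coefZ coef_mon (inj_eq (addIr _)).
Qed.

Lemma coef_theta2 e f : coef e (theta2 f) = e.2%:~R * coef e f.
Proof.
rewrite /theta2 coef_monM /pd2 coef_sum.
rewrite (eq_bigr (fun m : Z2 => (m.2%:~R * coef m f) * (m == e)%:R)) => [|m _].
  by rewrite (sum_supp_delta (F := fun m : Z2 => m.2%:~R * coef m f)) // => ->; rewrite mulr0.
by rewrite coefZ coef_mon (inj_eq (addIr _)).
Qed.

Definition point (e : Z2) : 'I_2 -> K :=
  fun i => (if i == ord0 then e.1 else e.2)%:~R.

Lemma point_h1 e : h1.@[point e] = e.2%:~R.
Proof. by rewrite mevalXU. Qed.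

Lemma point_h2 n e : (h2 n).@[point e] = (n%:Z * e.1 - e.2)%:~R.
Proof. by rewrite mevalB mevalMn !mevalXU /point /= rmorphB rmorphM /= mulr_natl. Qed.

(** Monomials are common eigenvectors of theta_1 and theta_2, the eigenvalues being the coordinates
    of the exponent. *)
Lemma coef_op e p f : coef e (op_of_poly p f) = p.@[point e] * coef e f.
Proof.
rewrite /op_of_poly coef_sum mevalE mulr_suml; apply: eq_bigr => m _.
rewrite coefZ -mulrA; congr (_ * _).
have it2 k g : coef e (iter k (@theta2 K) g) = e.2%:~R ^+ k * coef e g.
  by elim: k => [|k IHk]; rewrite ?mul1r //= coef_theta2 IHk mulrA -exprS.
have it1 k g : coef e (iter k (@theta1 K) g) = e.1%:~R ^+ k * coef e g.
  by elim: k => [|k IHk]; rewrite ?mul1r //= coef_theta1 IHk mulrA -exprS.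
rewrite it1 it2 mulrA; congr (_ * _).
rewrite !big_ord_recl big_ord0 mulr1.
by rewrite (_ : lift ord0 ord0 = ord_max) //; apply: val_inj.
Qed.

Lemma coef_shift e d p f :
  coef e (mon K d * op_of_poly p f) = p.@[point (e - d)] * coef (e - d) f.
Proof. by rewrite coef_monM coef_op. Qed.

Lemma coef_shift_mon m d p e :
  coef e (mon K d * op_of_poly p (mon K m)) = p.@[point m] * (m + d == e)%:R.
Proof.
rewrite coef_shift coef_mon eq_sym subr_eq eq_sym.
by have [<-|] := eqVneq (m + d) e; rewrite ?mulr0 // addrK.
Qed.

Lemma shift_mon m d p :
  mon K d * op_of_poly p (mon K m) = p.@[point m] *: mon K (m + d).
Proof. by apply: coefP => e; rewrite coef_shift_mon coefZ coef_mon. Qed.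

Lemma shift_linear d p : linear (fun f : L => mon K d * op_of_poly p f).
Proof.
move=> a f g; apply: coefP => e.
rewrite [LHS]coef_monM coef_op coefD coefZ [RHS]coefD coefZ.
by rewrite (coef_shift e d p f) (coef_shift e d p g) mulrDr mulrCA.
Qed.

End Coefficients.

(** * The lattice points of R_A and J *)

Definition cone (n : nat) : set Z2 :=
  [set d | 0 <= d.2 /\ 0 <= n%:Z * d.1 - d.2].
Definition inner_cone (n : nat) : set Z2 :=
  [set d | 0 < d.2 /\ 0 < n%:Z * d.1 - d.2].

Lemma Z2_fstD (x y : Z2) : (x + y).1 = x.1 + y.1. Proof. by []. Qed.
Lemma Z2_sndD (x y : Z2) : (x + y).2 = x.2 + y.2. Proof. by []. Qed.
Lemma Z2_fstN (x : Z2) : (- x).1 = - x.1. Proof. by []. Qed.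
Lemma Z2_sndN (x : Z2) : (- x).2 = - x.2. Proof. by []. Qed.
Definition Z2E := (Z2_fstD, Z2_sndD, Z2_fstN, Z2_sndN).

Lemma Z2_eq (x y : Z2) : x.1 = y.1 -> x.2 = y.2 -> x = y.
Proof. by case: x y => [? ?] [? ?] /= -> ->. Qed.

Lemma coneD n x y : cone n x -> cone n y -> cone n (x + y).
Proof.
by case: x y => [? ?] [? ?] [/= ? ?] [/= ? ?]; split; rewrite !Z2E /=; lia.
Qed.

Lemma cone0 n : cone n 0.
Proof. by split=> //=; rewrite mulr0 subr0. Qed.

Lemma coneMn n x k : cone n x -> cone n (x *+ k).
Proof.
move=> nx; elim: k => [|k IHk]; first by rewrite mulr0n; exact: cone0.
by rewrite mulrS; exact: coneD.
Qed.

Lemma cone_gen n i : (i <= n)%N -> cone n (1, i%:Z).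
Proof. by move=> le_in; split=> //=; lia. Qed.

Lemma inner_coneDl n x y : inner_cone n x -> cone n y -> inner_cone n (x + y).
Proof.
by case: x y => [? ?] [? ?] [/= ? ?] [/= ? ?]; split; rewrite !Z2E /=; lia.
Qed.

Lemma inner_cone_sub n : inner_cone n `<=` cone n.
Proof. by move=> x [? ?]; split; exact: ltW. Qed.

Lemma NA_gen n (i : 'I_n.+1) x : NA n x -> NA n ((1, (i : nat)%:Z) + x).
Proof.
move=> [c ->]; exists (fun j => ((j == i) + c j)%N).
under [in RHS]eq_bigr do rewrite mulrnDr.
rewrite big_split /=; congr (_ + _).
rewrite (bigD1 i) //= eqxx mulr1n big1 ?addr0 // => j /negPf ->.
by rewrite mulr0n.
Qed.

Lemma NA_cone n : (0 < n)%N -> NA n = cone n.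
Proof.
move=> n_gt0; apply/seteqP; split=> [d [c ->]|].
  elim/big_ind: _ => [||i _]; [exact: cone0|exact: coneD|].
  by apply/coneMn/cone_gen; rewrite -ltnS.
suff NAnat : forall a b, (b <= n * a)%N -> NA n (a%:Z, b%:Z).
  move=> [[a|a] [b|b]] [] /= ? ?; try nia.
  by apply: NAnat; lia.
elim=> [|a IHa] b.
  rewrite muln0 leqn0 => /eqP ->; exists (fun=> 0%N).
  by rewrite big1.
(* Split off the generator (1, min(b, n)). The rest has second coordinate b - n or 0, hence at most
   n a. *)
move=> bn; pose i := minn b n; have lt_in : (i < n.+1)%N by rewrite /i; lia.
have -> : (a.+1%:Z, b%:Z) = (1, (Ordinal lt_in : nat)%:Z) + (a%:Z, (b - i)%:Z) :> Z2.
  by apply: Z2_eq; rewrite Z2E /= /i; lia.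
by apply/NA_gen/IHa; rewrite /i; nia.
Qed.

Lemma inner_cone_split n d : (1 < n)%N -> inner_cone n d ->
  exists2 i, (1 <= i < n)%N & cone n (d - (1, i%:Z)).
Proof.
case: d => d1 d2 n_gt1 [/= d2_gt0 d_gt0]; have d1_gt0 : 0 < d1 by nia.
(* For d_2 < n, taking i = d_2 leaves a point on the facet h_1 = 0. Otherwise i = n - 1 leaves h_1
   >= 1 and lowers h_2 by exactly 1, so h_2 stays nonnegative. *)
exists (if d2 < n%:Z then absz d2 else n.-1).
  by case: ifP => ?; nia.
case: ifP => d2n; split; rewrite !Z2E /=.
- by lia.
- by nia.
- by lia.
- by lia.
Qed.

Section SupportedIn.
Variable K : comNzRingType.
Local Notation L := (laurent K).

Definition supported (S : set Z2) : set L :=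
  [set f | forall m, coef m f != 0 -> S m].

Lemma supported0 S : supported S 0.
Proof. by move=> m; rewrite coef0 eqxx. Qed.

Lemma supportedD S f g : supported S f -> supported S g -> supported S (f + g).
Proof.
move=> Sf Sg m; rewrite coefD; have [->|/Sf//] := eqVneq (coef m f) 0.
by rewrite add0r => /Sg.
Qed.

Lemma supportedZ S (a : K) f : supported S f -> supported S (a *: f).
Proof.
move=> Sf m; rewrite coefZ; have [->|/Sf//] := eqVneq (coef m f) 0.
by rewrite mulr0 eqxx.
Qed.

Lemma supported_sum S (I : eqType) (r : seq I) (P : pred I) (F : I -> L) :
  (forall i, i \in r -> P i -> supported S (F i)) ->
  supported S (\sum_(i <- r | P i) F i).
Proof.
rewrite big_seq_cond => SF; elim/big_ind: _ => [||i /andP[]].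
- exact: supported0.
- exact: supportedD.
- exact: SF.
Qed.

Lemma supported_mon (S : set Z2) d : S d -> supported S (mon K d).
Proof.
move=> Sd m; rewrite coef_mon.
by have [<-//|] := eqVneq d m; rewrite eqxx.
Qed.

Lemma supportedM S T U f g :
  (forall x y, S x -> T y -> U (x + y)) ->
  supported S f -> supported T g -> supported U (f * g).
Proof.
move=> STU Sf Tg; rewrite (laurentE f) (laurentE g) mulr_suml.
apply: supported_sum => x; rewrite mem_supp => /Sf Sx _; rewrite mulr_sumr.
apply: supported_sum => y; rewrite mem_supp => /Tg Ty _.
rewrite -scalerAl -scalerAr monM; do 2!apply: supportedZ.
by apply: supported_mon; exact: STU.
Qed.

Lemma supported_span S (P : set L) :
  P 0 -> (forall f g, P f -> P g -> P (f + g)) ->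
  (forall (a : K) m, S m -> P (a *: mon K m)) ->
  supported S `<=` P.
Proof.
move=> P0 PD PS f Sf; rewrite (laurentE f) big_seq_cond.
by elim/big_ind: _ => // m /andP[]; rewrite mem_supp => /Sf /PS.
Qed.

Lemma mon_sum (I : finType) (F : I -> Z2) :
  mon K (\sum_i F i) = \prod_i mon K (F i).
Proof. exact: (big_morph (mon K) (fun x y => esym (monM K x y)) (mon0 K)). Qed.

Lemma mon_Mn (d : Z2) k : mon K (d *+ k) = mon K d ^+ k.
Proof.
elim: k => [|k IHk]; first by rewrite mulr0n expr0 mon0.
by rewrite mulrS exprS -monM IHk.
Qed.

Lemma toL_X n (m : 'X_{1.. n.+1}) :
  mmap1 (fun i : 'I_n.+1 => mon K (1, (i : nat)%:Z)) m =
  mon K (\sum_(i < n.+1) ((1, (i : nat)%:Z) : Z2) *+ m i).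
Proof. by rewrite mon_sum; apply: eq_bigr => i _; rewrite mon_Mn. Qed.

Lemma RA_supported n : (0 < n)%N -> RA K n = supported (cone n).
Proof.
move=> n_gt0; rewrite -NA_cone //; apply/seteqP; split=> [f [p ->]|].
  rewrite /mmap; apply: supported_sum => m _ _.
  rewrite mulr_algl toL_X; apply: supportedZ; apply: supported_mon.
  by exists m.
apply: supported_span => [|f g [p ->] [q ->]|a m].
- by exists 0; exact/esym/(mmap0 _ (GRing.in_alg L)).
- by exists (p + q); exact/esym/(mmapD _ (GRing.in_alg L)).
move=> [c ->]; exists (a *: 'X_[[multinom c i | i < n.+1]]).
rewrite (mmapZ _ (GRing.in_alg L)) (mmapX _ (GRing.in_alg L)) mulr_algl toL_X; congr (_ *: mon K _).
by apply: eq_bigr => i _; rewrite mnmE.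
Qed.

(** The generators of J have interior exponents, and adding a cone point keeps a point in the
    interior. Conversely [inner_cone_split] factors each interior monomial as a generator times a
    monomial of R_A. *)
Lemma J_supported n : (1 < n)%N -> J K n = supported (inner_cone n).
Proof.
move=> n_gt1; have n_gt0 := ltnW n_gt1; apply/seteqP; split=> [f [r Rr ->]|].
  rewrite big_nat; apply: supported_sum => i _ /andP[i_gt0 i_ltn].
  apply: (@supportedM (cone n) (inner_cone n)) => [x y xn yn||].
  - by rewrite addrC; exact: inner_coneDl.
  - by rewrite -RA_supported //.
  - by apply: supported_mon; split=> /=; lia.
apply: supported_span => [|f g [p Rp ->] [q Rq ->]|a m /(inner_cone_split n_gt1) [i i_n mi]].
- exists (fun=> 0) => [_|]; first by rewrite RA_supported //; exact: supported0.
  by rewrite big1 // => i _; rewrite mul0r.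
- exists (fun i => p i + q i) => [i|].
    by rewrite RA_supported //; apply: supportedD; rewrite -RA_supported //.
  by rewrite -big_split; apply: eq_bigr => i _; rewrite mulrDl.
exists (fun j => if j == i then a *: mon K (m - (1, i%:Z)) else 0) => [j|].
  rewrite RA_supported //; case: ifP => _; last exact: supported0.
  by apply: supportedZ; exact: supported_mon.
rewrite (bigD1_seq i) ?iota_uniq ?mem_index_iota //= eqxx big1 => [|j /negPf ->].
  by rewrite addr0 -scalerAl monM subrK.
by rewrite mul0r.
Qed.

End SupportedIn.

(** * Differential operators and finite differences *)

(** Each term is built from its coefficient by multiplying by one variable at a time. *)
Lemma mpoly_ring_ind (n : nat) (R : comNzRingType) (P : {mpoly R[n]} -> Prop) :
  (forall c, P c%:MP) -> (forall p q, P p -> P q -> P (p + q)) ->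
  (forall i p, P p -> P ('X_i * p)) -> forall p, P p.
Proof.
move=> PC PD PX p; rewrite (mpolyE p); elim/big_ind: _ => [||m _] //.
  by rewrite -mpolyC0.
rewrite -mul_mpolyC mulrC mpolyXE_id; set c := _%:MP.
elim: (index_enum _) => [|i r IHr]; first by rewrite big_nil mul1r; exact: PC.
rewrite big_cons -mulrA; elim: (m i) => [|k IHk]; first by rewrite mul1r.
by rewrite exprS -mulrA; exact: PX.
Qed.

Section Symbols.
Variable K : comNzRingType.
Local Notation L := (laurent K).

Lemma linear_expand (delta : L -> L) f : linear delta ->
  delta f = \sum_(m <- supp f) coef m f *: delta (mon K m).
Proof.
move=> dl.
have dD g h : delta (g + h) = delta g + delta h.
  by have := dl 1 g h; rewrite !scale1r.
have d0 : delta 0 = 0.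
  by apply: (addrI (delta 0)); rewrite -dD !addr0.
have dZ a g : delta (a *: g) = a *: delta g.
  by have := dl a g 0; rewrite d0 !addr0.
rewrite [in LHS](laurentE f) (big_morph delta dD d0).
by apply: eq_bigr => m _; rewrite dZ.
Qed.

Lemma linear_ext (delta eps : L -> L) : linear delta -> linear eps ->
  (forall m, delta (mon K m) = eps (mon K m)) -> delta = eps.
Proof.
move=> dl el de; apply/funext => f; rewrite !linear_expand //.
by apply: eq_bigr => m _; rewrite de.
Qed.

Lemma zero_linear : linear (0 : L -> L).
Proof. by move=> a f g; rewrite /= scaler0 addr0. Qed.

(* The discrete way of saying that g is polynomial of degree < k. *)
Fixpoint poly_lt (k : nat) (g : Z2 -> L) : Prop :=
  if k is k'.+1 then forall e, poly_lt k' (fun m => g (m + e) - g m)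
  else forall m, g m = 0.

Lemma eq_poly_lt k g h : g =1 h -> poly_lt k g -> poly_lt k h.
Proof. by move=> /funext ->. Qed.

Lemma poly_lt0 k : poly_lt k (fun=> 0).
Proof.
by elim: k => //= k IHk e; apply: eq_poly_lt IHk => m; rewrite subr0.
Qed.

Lemma poly_ltD k g h : poly_lt k g -> poly_lt k h ->
  poly_lt k (fun m => g m + h m).
Proof.
elim: k g h => [|k IHk] g h /= gk hk => [m|e]; first by rewrite gk hk addr0.
by apply: eq_poly_lt (IHk _ _ (gk e) (hk e)) => m; rewrite addrACA opprD.
Qed.

Lemma poly_ltM k a g : poly_lt k g -> poly_lt k (fun m => a * g m).
Proof.
elim: k g => [|k IHk] g /= gk => [m|e]; first by rewrite gk mulr0.
by apply: eq_poly_lt (IHk _ (gk e)) => m; rewrite mulrBr.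
Qed.

Lemma poly_ltZ k (a : K) g : poly_lt k g -> poly_lt k (fun m => a *: g m).
Proof. by move=> /(poly_ltM a%:A); apply: eq_poly_lt => m; rewrite mulr_algl. Qed.

Lemma poly_lt_sum k (r : seq Z2) (G : Z2 -> Z2 -> L) :
  (forall i, poly_lt k (G i)) -> poly_lt k (fun m => \sum_(i <- r) G i m).
Proof.
move=> Gk; elim: r => [|i r IHr].
  by apply: eq_poly_lt (poly_lt0 k) => m; rewrite big_nil.
by apply: eq_poly_lt (poly_ltD (Gk i) IHr) => m; rewrite big_cons.
Qed.

Lemma poly_lt_translate k g e : poly_lt k g -> poly_lt k (fun m => g (m + e)).
Proof.
elim: k g => [|k IHk] g /= gk => [m|e']; first exact: gk.
by apply: eq_poly_lt (IHk _ (gk e')) => m; rewrite addrAC.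
Qed.

Lemma poly_ltS k g : poly_lt k g -> poly_lt k.+1 g.
Proof.
move=> gk e; have := poly_ltD (poly_lt_translate e gk) (poly_ltZ (-1) gk).
by apply: eq_poly_lt => m; rewrite scaleN1r.
Qed.

Lemma poly_lt_le k l g : (k <= l)%N -> poly_lt k g -> poly_lt l g.
Proof. by move=> /subnK <-; elim: (l - k)%N => // i IHi /IHi /poly_ltS. Qed.

Definition symbol (delta : L -> L) (m : Z2) : L := mon K (- m) * delta (mon K m).

Lemma symbolK delta m : mon K m * symbol delta m = delta (mon K m).
Proof. by rewrite mulrA monM subrr mon0 mul1r. Qed.

Definition commutator (delta : L -> L) (a : L) : L -> L :=
  fun f => delta (a * f) - a * delta f.

Lemma commutator_linear delta a : linear delta -> linear (commutator delta a).
Proof.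
move=> dl c f g; rewrite /commutator mulrDr -scalerAr !dl mulrDr -scalerAr.
by rewrite scalerBr opprD addrACA.
Qed.

(** For a = s^e both terms of the commutator carry a factor s^e, and what remains is the difference
    of the symbol in direction e. Linearity in a gives the general case. *)
Lemma symbol_commutator delta a m : linear delta ->
  symbol (commutator delta a) m =
  \sum_(e <- supp a) (coef e a *: mon K e) * (symbol delta (m + e) - symbol delta m).
Proof.
move=> dl; rewrite /symbol /commutator.
have -> : delta (a * mon K m) = \sum_(e <- supp a) coef e a *: delta (mon K (m + e)).
  have ml : linear (fun f : L => delta (f * mon K m)).
    by move=> c f g; rewrite mulrDl -scalerAl dl.
  rewrite (linear_expand _ ml); apply: eq_bigr => e _.
  by rewrite monM addrC.
rewrite [X in _ - X * _](laurentE a) mulr_suml -sumrB mulr_sumr.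
apply: eq_bigr => e _; rewrite !mulrBr; congr (_ - _); last by rewrite mulrCA.
rewrite -scalerAr -scalerAl; congr (_ *: _).
by rewrite mulrA monM opprD addrA addrAC subrr add0r.
Qed.

Lemma diffop_ltP k delta :
  diffop_lt k delta <-> linear delta /\ poly_lt k (symbol delta).
Proof.
elim: k delta => [|k IHk] delta; split.
- by move=> ->; split=> [|m]; [exact: zero_linear|rewrite /symbol mulr0].
- move=> [dl d0]; apply: linear_ext => // [|m]; first exact: zero_linear.
  by rewrite -symbolK d0 mulr0.
- move=> [dl dk]; split=> // e.
  (* The symbol of the commutator with s^e is s^e times the difference in direction e; multiplying
     by s^-e isolates the difference. *)
  have [_] := (IHk _).1 (dk (mon K e)).
  move=> /(poly_ltM (mon K (- e))); apply: eq_poly_lt => m.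
  rewrite /symbol /commutator monM !mulrBr !mulrA !monM addrAC addNr add0r.
  by rewrite opprD (addrC (- m)) (addrC e).
move=> [dl dk]; split=> // a; apply/IHk; split; first exact: commutator_linear.
have := @poly_lt_sum k (supp a) (fun e m => (coef e a *: mon K e) * (symbol delta (m + e) - symbol delta m)).
move=> /(_ (fun e => poly_ltM _ (dk e))); apply: eq_poly_lt => m.
by rewrite symbol_commutator.
Qed.

(** Discrete Leibniz rule: the difference of c g in direction e is c(m) (g(m + e) - g(m)) + c(e) g(m
    + e). Induction handles the first summand; the second is a multiple of a translate of g. *)
Lemma poly_lt_mulcoord k (c : Z2 -> K) g :
  (forall m e, c (m + e) = c m + c e) ->
  poly_lt k g -> poly_lt k.+1 (fun m => c m *: g m).
Proof.
move=> cD; elim: k g => [|k IHk] g gk e.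
  by move=> m; rewrite !gk !scaler0 subr0.
have := poly_ltD (IHk _ (gk e)) (poly_ltZ (c e) (poly_lt_translate e gk)).
by apply: eq_poly_lt => m; rewrite cD scalerBr scalerDl addrAC.
Qed.

Lemma poly_lt_mpoly (p : {mpoly K[2]}) :
  exists k, forall x, poly_lt k (fun m => p.@[point K m] *: x).
Proof.
elim/mpoly_ring_ind: p => [c|p q [k pk] [l ql]|i p [k pk]].
- by exists 1%N => x e m; rewrite !mevalC subrr.
- exists (maxn k l) => x.
  have := poly_ltD (poly_lt_le (leq_maxl k l) (pk x)) (poly_lt_le (leq_maxr k l) (ql x)).
  by apply: eq_poly_lt => m; rewrite mevalD scalerDl.
exists k.+1 => x.
have cD (m e : Z2) : point K (m + e) i = point K m i + point K e i.
  by rewrite /point; case: ifP => _; rewrite -rmorphD.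
by apply: eq_poly_lt (poly_lt_mulcoord cD (pk x)) => m; rewrite mevalM mevalXU scalerA.
Qed.

Lemma diffop_shift d p : diffop (fun f : L => mon K d * op_of_poly p f).
Proof.
have [k pk] := poly_lt_mpoly p; exists k; apply/diffop_ltP; split.
  exact: shift_linear.
apply: eq_poly_lt (pk (mon K d)) => m.
by rewrite /symbol shift_mon -scalerAr monM addKr.
Qed.

Lemma diffop0 : diffop (0 : L -> L).
Proof. by exists 0%N. Qed.

Lemma diffopD (delta eps : L -> L) : diffop delta -> diffop eps -> diffop (delta + eps).
Proof.
move=> [k /diffop_ltP[dl dk]] [l /diffop_ltP[el ek]].
exists (maxn k l); apply/diffop_ltP; split.
  by move=> a f g; rewrite !addrfctE dl el scalerDr addrACA.
have := poly_ltD (poly_lt_le (leq_maxl k l) dk) (poly_lt_le (leq_maxr k l) ek).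
by apply: eq_poly_lt => m; rewrite /symbol addrfctE mulrDr.
Qed.

Lemma diffop_linear (delta : L -> L) : diffop delta -> linear delta.
Proof. by move=> [k /diffop_ltP[]]. Qed.

End Symbols.

(** * Newton interpolation of symbols *)

Section NewtonExpansion.
Variable K : numFieldType.
Local Notation L := (laurent K).

(** The binomial coefficient [x] choose [k], as a polynomial function of [x]. *)
Definition newton (k : nat) (x : K) : K :=
  (k`!%:R)^-1 * \prod_(j < k) (x - (j : nat)%:R).

Lemma newton0 x : newton 0 x = 1.
Proof. by rewrite /newton big_ord0 mulr1 invr1. Qed.

(** Pascal's rule: the two products share the factor x (x - 1) ... (x - k + 1), and their remaining
    factors x + 1 and x - k differ by k + 1. *)
Lemma newton_diff k x : newton k.+1 (x + 1) - newton k.+1 x = newton k x.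
Proof.
rewrite /newton -mulrBr big_ord_recl big_ord_recr /= subr0.
rewrite (eq_bigr (fun j : 'I_k => x - (j : nat)%:R)) => [|j _]; last first.
  by rewrite /bump /= natrD; ring.
set q := \prod_(j < k) _.
have -> : (x + 1) * q - q * (x - k%:R) = k.+1%:R * q by rewrite -natr1; ring.
by rewrite factS natrM invfM mulrACA mulVf ?mul1r // pnatr_eq0.
Qed.

(* The functions of m spanned over L by the products of Newton polynomials in
   the two coordinates; on this basis differences in one coordinate merely lower
   an index, so that they are easily inverted. *)
Definition newton_span (g : Z2 -> L) : Prop :=
  exists s : seq (nat * nat * L), forall m : Z2,
    g m = \sum_(x <- s) (newton x.1.1 m.1%:~R * newton x.1.2 m.2%:~R) *: x.2.

Lemma newton_span_cst a : newton_span (fun=> a).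
Proof.
by exists [:: (0%N, 0%N, a)] => m; rewrite big_seq1 !newton0 mul1r scale1r.
Qed.

Lemma newton_spanD g h : newton_span g -> newton_span h ->
  newton_span (fun m => g m + h m).
Proof. by move=> [s gs] [t ht]; exists (s ++ t) => m; rewrite big_cat gs ht. Qed.

Lemma newton_spanN g : newton_span g -> newton_span (fun m => - g m).
Proof.
move=> [s gs]; exists [seq (x.1, - x.2) | x <- s] => m.
by rewrite gs big_map -sumrN; apply: eq_bigr => x _; rewrite scalerN.
Qed.

(** At m_1 = 0 the first Newton factor becomes a scalar, which is absorbed into the coefficient. *)
Lemma newton_span_axis g : newton_span g -> newton_span (fun m => g (0, m.2)).
Proof.
move=> [s gs]; exists [seq (0%N, x.1.2, newton x.1.1 0 *: x.2) | x <- s] => m.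
rewrite gs big_map; apply: eq_bigr => x _ /=.
by rewrite newton0 mul1r scalerA mulrC.
Qed.

Lemma newton_span_antidiff1 q : newton_span q ->
  exists2 Q, newton_span Q & forall m, Q (m + (1, 0)) - Q m = q m.
Proof.
move=> [s qs]; pose t := [seq (x.1.1.+1, x.1.2, x.2) | x <- s].
exists (fun m : Z2 => \sum_(x <- t) (newton x.1.1 m.1%:~R * newton x.1.2 m.2%:~R) *: x.2).
  by exists t.
move=> m; rewrite qs !big_map -sumrB; apply: eq_bigr => x _ /=.
by rewrite -scalerBl addr0 -mulrBl rmorphD /= newton_diff.
Qed.

Lemma newton_span_antidiff2 q : newton_span q ->
  exists2 Q, newton_span Q & forall m, Q (m + (0, 1)) - Q m = q m.
Proof.
move=> [s qs]; pose t := [seq (x.1.1, x.1.2.+1, x.2) | x <- s].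
exists (fun m : Z2 => \sum_(x <- t) (newton x.1.1 m.1%:~R * newton x.1.2 m.2%:~R) *: x.2).
  by exists t.
move=> m; rewrite qs !big_map -sumrB; apply: eq_bigr => x _ /=.
by rewrite -scalerBl addr0 -mulrBr rmorphD /= newton_diff.
Qed.

Lemma int_periodic (T : Type) (h : int -> T) :
  (forall x, h (x + 1) = h x) -> forall x, h x = h 0.
Proof.
move=> h1; elim/int_ind => [|k <-|k <-] //; last first.
  by rewrite -[LHS]h1; congr h; lia.
by rewrite -[RHS]h1; congr h; lia.
Qed.

Lemma sub_diff_eq (V : zmodType) (a a' b b' : V) :
  b' - b = a' - a -> a' - b' = a - b.
Proof.
move=> e; rewrite -[a'](subrK a) -e addrAC [b' - b]addrC addrK.
exact: addrC.
Qed.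

(** Discrete integration. [Q] has the same differences as g along (1, 0), so g - Q depends on m_2
    only; on the axis m_1 = 0, [T] has the same differences as g along (0, 1), so g - T is constant
    there. Together g is recovered from [Q], [T] and one constant. *)
Lemma poly_lt_newton_span k g : poly_lt k g -> newton_span g.
Proof.
elim: k g => [|k IHk] g /= gk.
  by exists [::] => m; rewrite big_nil gk.
have [Q QN Qd] := newton_span_antidiff1 (IHk _ (gk (1, 0))).
have [T TN Td] := newton_span_antidiff2 (newton_span_axis (IHk _ (gk (0, 1)))).
have per1 (m : Z2) : g m - Q m = g (0, m.2) - Q (0, m.2).
  case: m => m1 m2 /=.
  pose h (x : int) := g (x, m2) - Q (x, m2).
  suff h1 x : h (x + 1) = h x by exact: (@int_periodic _ h h1 m1).
  have := Qd (x, m2); rewrite (_ : (x, m2) + (1, 0) = (x + 1, m2)); last first.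
    by apply: Z2_eq; rewrite Z2E //= addr0.
  exact: sub_diff_eq.
have per2 (y : int) : g (0, y) - T (0, y) = g (0, 0) - T (0, 0).
  pose h (y : int) := g (0, y) - T (0, y).
  suff h1 x : h (x + 1) = h x by exact: (@int_periodic _ h h1 y).
  have := Td (0, x); rewrite (_ : (0, x) + (0, 1) = (0, x + 1)) /=; last first.
    by apply: Z2_eq; rewrite Z2E.
  exact: sub_diff_eq.
have gE m : g m = (Q m - Q (0, m.2)) + (T (0, m.2) + (g (0, 0) - T (0, 0))).
  rewrite -(per2 m.2) [T _ + _]addrC subrK -[LHS](subrK (Q m)) per1.
  by rewrite [LHS]addrC addrA addrAC.
have Q0 := newton_spanN (newton_span_axis QN).
have T0 := newton_spanD (newton_span_axis TN) (newton_span_cst (g (0, 0) - T (0, 0))).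
by have := newton_spanD (newton_spanD QN Q0) T0; congr newton_span; apply/funext => m.
Qed.

Definition newtonX (k : nat) (i : 'I_2) : {mpoly K[2]} :=
  (k`!%:R)^-1 *: \prod_(j < k) ('X_i - ((j : nat)%:R)%:MP).

Lemma point_newtonX k i (m : Z2) :
  (newtonX k i).@[point K m] = newton k (point K m i).
Proof.
rewrite /newtonX /newton mevalZ; congr (_ * _).
rewrite (big_morph _ (mevalM _) (meval1 _)); apply: eq_bigr => j _.
by rewrite mevalB mevalXU mevalC.
Qed.

(** p_d is the coefficient at s^d of the Newton expansion of the symbol. The expansion has finitely
    many coefficients in L, and [D] collects the exponents occurring in them. *)
Lemma diffop_expansion (delta : L -> L) : diffop delta ->
  exists (D : seq Z2) (p : Z2 -> {mpoly K[2]}),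
    [/\ uniq D, forall d, d \notin D -> p d = 0 &
        forall m d, coef (m + d) (delta (mon K m)) = (p d).@[point K m]].
Proof.
move=> [k /diffop_ltP[dl /poly_lt_newton_span[s ds]]].
pose p d := \sum_(x <- s) coef d x.2 *: (newtonX x.1.1 ord0 * newtonX x.1.2 ord_max).
exists (undup (flatten [seq supp x.2 | x <- s])), p; split=> [|d dD|m d].
- exact: undup_uniq.
- rewrite /p big_seq big1 // => x xs; have [->|dx] := eqVneq (coef d x.2) 0.
    by rewrite scale0r.
  case/negP: dD; rewrite mem_undup; apply/flattenP; exists (supp x.2).
    by apply/mapP; exists x.
  by rewrite mem_supp.
rewrite -symbolK coef_monM addrAC subrr add0r ds coef_sum.
rewrite /p (big_morph _ (mevalD _) (meval0 _)); apply: eq_bigr => x _.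
by rewrite coefZ mevalZ mevalM !point_newtonX mulrC.
Qed.

End NewtonExpansion.

(** * Gradings *)

Section RestrictedOperators.
Variable K : numFieldType.
Local Notation L := (laurent K).
Implicit Types (good : Z2 -> Z2 -> Prop) (delta : L -> L).

(** [good m e] tells which matrix entries, from s^m to s^e, may be nonzero. Both the idealizer and
    D(R_A, J) have this form, so that gradedness is proved once for all. *)
Definition restricted_diffop good : set (L -> L) :=
  [set delta | diffop delta /\
    forall m e, coef e (delta (mon K m)) != 0 -> good m e].

Lemma restricted0 good : restricted_diffop good 0.
Proof. by split=> [|m e]; [exact: diffop0|rewrite coef0 eqxx]. Qed.

Lemma restrictedD good delta eps : restricted_diffop good delta ->
  restricted_diffop good eps -> restricted_diffop good (delta + eps).
Proof.
move=> [dd dg] [ed eg]; split=> [|m e]; first exact: diffopD.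
rewrite addrfctE coefD.
by have [->|/dg//] := eqVneq (coef e (delta (mon K m))) 0; rewrite add0r => /eg.
Qed.

Lemma restricted_sum good (D : seq Z2) (c : Z2 -> L -> L) :
  (forall d, restricted_diffop good (c d)) ->
  restricted_diffop good (\sum_(d <- D) c d).
Proof.
move=> Mc; elim/big_ind: _ => // [|? ?]; first exact: restricted0.
exact: restrictedD.
Qed.

Lemma restricted_shift good d p :
  restricted_diffop good (fun f => mon K d * op_of_poly p f) <->
  forall m, p.@[point K m] != 0 -> good m (m + d).
Proof.
split=> [[_ pg] m pm|pg].
  by apply: pg; rewrite coef_shift_mon eqxx mulr1.
split=> [|m e]; first exact: diffop_shift.
rewrite coef_shift_mon; have [<-|_] := eqVneq (m + d) e; last by rewrite mulr0 eqxx.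
by rewrite mulr1; exact: pg.
Qed.

Lemma piece_restricted good d :
  piece (restricted_diffop good) d =
  shift d [set p | forall m, p.@[point K m] != 0 -> good m (m + d)].
Proof.
apply/seteqP; split=> delta; last first.
  by move=> [p pg ->]; split; [exact/restricted_shift|exists p].
by move=> [Md [p _ dE]]; exists p => //; apply/restricted_shift; rewrite -dE.
Qed.

Lemma shift_coef_out d (I : set {mpoly K[2]}) delta m e :
  shift d I delta -> m + d != e -> coef e (delta (mon K m)) = 0.
Proof. by move=> [p _ ->] /negPf me; rewrite coef_shift_mon me mulr0. Qed.

Lemma shift_coef_inj d (I I' : set {mpoly K[2]}) delta eps :
  shift d I delta -> shift d I' eps ->
  (forall m, coef (m + d) (delta (mon K m)) = coef (m + d) (eps (mon K m))) ->
  delta = eps.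
Proof.
move=> sd se de; apply: linear_ext => [||m].
- by case: sd => p _ ->; exact: shift_linear.
- by case: se => p _ ->; exact: shift_linear.
apply: coefP => e; have [<-|me] := eqVneq (m + d) e; first exact: de.
by rewrite (shift_coef_out sd me) (shift_coef_out se me).
Qed.

(** Only the component of degree d sends s^m to a multiple of s^(m+d). Hence [delta] determines its
    components, which gives uniqueness of the decomposition. *)
Lemma decomposition_coef M delta c m d : homogeneous_decomposition M delta c ->
  coef (m + d) (delta (mon K m)) = coef (m + d) (c d (mon K m)).
Proof.
move=> [cM [D [uD cD ->]]]; rewrite fct_sumE coef_sum.
have c0 i : i != d -> coef (m + d) (c i (mon K m)) = 0.
  by case: (cM i) => _ /shift_coef_out ci id; apply: ci; rewrite (inj_eq (addrI m)).
have [dD|dD] := boolP (d \in D); last first.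
  rewrite cD // coef0 big_seq big1 // => i iD; apply: c0.
  by apply: contraNneq dD => <-.
by rewrite (bigD1_seq d) //= big1 ?addr0.
Qed.

Lemma restricted_decomposition good delta : restricted_diffop good delta ->
  exists c, homogeneous_decomposition (restricted_diffop good) delta c.
Proof.
move=> [dd dg]; have [D [p [uD pD pE]]] := diffop_expansion dd.
pose c d := fun f : L => mon K d * op_of_poly (p d) f.
exists c; split=> [d|].
  split; last by exists (p d).
  (* p_d(m) is itself a matrix entry of [delta], so each component inherits the restriction. *)
  by apply/restricted_shift => m; rewrite -pE; exact: dg.
exists D; split=> // [d dD|].
  apply/funext => f; apply: coefP => e.
  by rewrite coef_shift pD // meval0 mul0r coef0.
have cl : linear (\sum_(d <- D) c d).
  apply: diffop_linear; elim/big_ind: _ => [|? ? ? ?|d _].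
  - exact: diffop0.
  - exact: diffopD.
  - exact: diffop_shift.
apply: linear_ext => // [|m]; first exact: diffop_linear.
apply: coefP => e; rewrite fct_sumE coef_sum -(subrK m e) [_ + m]addrC pE.
set d := e - m.
have [dD|dD] := boolP (d \in D).
  rewrite (bigD1_seq d) //= coef_shift_mon eqxx mulr1 big1 ?addr0 // => i /negPf id.
  by rewrite coef_shift_mon (inj_eq (addrI m)) id mulr0.
rewrite pD // meval0 big_seq big1 // => i iD.
rewrite coef_shift_mon (inj_eq (addrI m)).
by have [id|] := eqVneq i d; [rewrite id (negPf dD) in iD|rewrite mulr0].
Qed.

Lemma restricted_Z2graded good : Z2graded (restricted_diffop good).
Proof.
move=> delta; split=> [/restricted_decomposition[c cdec]|[c [[cM [D [_ _ ->]]] _]]].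
  exists c; split=> // c' cdec'; apply/funext => d.
  have [[_ sc] [_ sc']] := (cdec.1 d, cdec'.1 d).
  apply: (shift_coef_inj sc sc') => m.
  by rewrite -(decomposition_coef _ _ cdec) -(decomposition_coef _ _ cdec').
by apply: restricted_sum => d; case: (cM d).
Qed.

Lemma supported_mapP (S T : set Z2) delta : linear delta ->
  (forall f, supported S f -> supported T (delta f)) <->
  (forall m e, coef e (delta (mon K m)) != 0 -> S m -> T e).
Proof.
move=> dl; split=> [dST m e de Sm|dST f Sf].
  by apply: dST de; exact: supported_mon.
rewrite linear_expand //; apply: supported_sum => m; rewrite mem_supp => /Sf Sm _.
by apply: supportedZ => e de; apply: dST de Sm.
Qed.

Lemma IJ_restricted n : (1 < n)%N ->
  IJ K n = restricted_diffop
    (fun m e => (cone n m -> cone n e) /\ (inner_cone n m -> inner_cone n e)).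
Proof.
move=> n1; rewrite /IJ /idealizer /diffop_sub RA_supported 1?ltnW // J_supported //.
apply/seteqP; split=> delta.
  move=> [[dd dR] dJ]; have dl := diffop_linear dd.
  split=> // m e de; split.
    by move: m e de; apply/supported_mapP.
  by move: m e de; apply/supported_mapP.
move=> [dd dg]; have dl := diffop_linear dd.
by split; [split=> //|]; apply/supported_mapP => // m e /dg[].
Qed.

Lemma DJ_restricted n : (1 < n)%N ->
  DJ K n = restricted_diffop (fun m e => cone n m -> inner_cone n e).
Proof.
move=> n1; rewrite /DJ /diffop_into /diffop_sub RA_supported 1?ltnW // J_supported //.
apply/seteqP; split=> delta.
  move=> [[dd dR] dJ]; have dl := diffop_linear dd.
  by split=> //; apply/supported_mapP.
move=> [dd dg]; have dl := diffop_linear dd.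
split; [split=> //|]; apply/supported_mapP => // m e /dg mi /mi //.
exact: inner_cone_sub.
Qed.

End RestrictedOperators.

(** * Vanishing on lines *)

Section LineDivisibility.
Variable K : numFieldType.
Local Notation CT := {mpoly K[2]}.

(** phi(theta_1) inside K[theta]; the zero set of theta_2 - phi(theta_1) is the graph of [phi]. *)
Definition embed_poly (phi : {poly K}) : CT :=
  (map_poly (@mpolyC 2 K) phi).['X_ord0].

Lemma meval_embed phi v : (embed_poly phi).@[v] = phi.[v ord0].
Proof.
rewrite /embed_poly; elim/poly_ind: phi => [|p c IHp].
  by rewrite rmorph0 !horner0 meval0.
rewrite rmorphD rmorphM /= map_polyX map_polyC !hornerMXaddC.
by rewrite mevalD mevalM IHp mevalXU mevalC.
Qed.

Lemma poly_eq0_nat (r : {poly K}) (B : nat) :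
  (forall x, (B <= x)%N -> r.[x%:R] = 0) -> r = 0.
Proof.
move=> r0; apply: (@roots_geq_poly_eq0 _ _ [seq x%:R | x <- iota B (size r)]).
- by apply/allP => y /mapP[x]; rewrite mem_iota => /andP[Bx _] ->; rewrite /root r0.
- by rewrite map_inj_uniq ?iota_uniq // => x y /eqP; rewrite eqr_nat => /eqP.
- by rewrite size_map size_iota.
Qed.

(* Modulo Y - phi(X) every polynomial is congruent to one in X alone, and the
   latter vanishes at infinitely many points. *)
Lemma graph_dvd (phi : {poly K}) (p : CT) (B : nat) :
  (forall x, (B <= x)%N ->
     p.@[fun i => if i == ord0 then x%:R else phi.[x%:R]] = 0) ->
  exists q, p = q * ('X_ord_max - embed_poly phi).
Proof.
have [q [r pE]] : exists q r, p = q * ('X_ord_max - embed_poly phi) + embed_poly r.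
  elim/mpoly_ring_ind: (p) => [c|p1 p2 [q1 [r1 ->]] [q2 [r2 ->]]|i p' [q [r ->]]].
  - by exists 0, c%:P; rewrite mul0r add0r /embed_poly map_polyC hornerC.
  - exists (q1 + q2), (r1 + r2).
    by rewrite /embed_poly rmorphD hornerD mulrDl addrACA.
  - have [->|i0] := eqVneq i ord0.
      exists ('X_ord0 * q), (r * 'X).
      by rewrite /embed_poly rmorphM /= map_polyX hornerMX mulrDr mulrA [X in _ + X]mulrC.
    have -> : i = ord_max by apply: val_inj; case: i i0 => [[|[|]]].
    exists ('X_ord_max * q + embed_poly r), (r * phi).
    have -> : embed_poly (r * phi) = embed_poly r * embed_poly phi.
      by rewrite /embed_poly rmorphM hornerM.
    by ring.
rewrite pE => p0; exists q; rewrite (_ : r = 0) ?/embed_poly ?rmorph0 ?horner0 ?addr0 //.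
apply: (@poly_eq0_nat _ B) => x /p0.
by rewrite mevalD mevalM mevalB mevalXU !meval_embed /= subrr mulr0 add0r.
Qed.

(** The linear factors are split off one by one. On the line h = k the factors h - i with i < k take
    the nonzero values k - i, so the quotient found so far still vanishes there and is divisible by
    h - k. *)
Lemma lines_dvd (h : CT) (pts : set Z2) (k : nat) (p : CT) :
  (forall (j : nat) (q : CT),
     (forall m, pts m -> h.@[point K m] = j%:R -> q.@[point K m] = 0) ->
     exists q', q = q' * (h - j%:R)) ->
  (forall m (j : nat), pts m -> (j < k)%N -> h.@[point K m] = j%:R ->
     p.@[point K m] = 0) ->
  exists q, p = q * \prod_(i < k) (h - (i : nat)%:R).
Proof.
move=> line; elim: k => [|k IHk] p0; first by exists p; rewrite big_ord0 mulr1.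
have [m j mP jk|q pE] := IHk; first by apply: p0 => //; exact: ltnW.
have [m mP hm|q' qE] := line k q; last by exists q'; rewrite big_ord_recr /= [X in _ * X]mulrC mulrA -qE.
apply/eqP; have /eqP := p0 m k mP (ltnSn k) hm; rewrite pE mevalM mulf_eq0 => /orP[//|].
rewrite (big_morph _ (mevalM _) (meval1 _)) => /eqP/eqP; rewrite prodf_seq_eq0 => /hasP[i _ /=].
rewrite mevalB -mpolyC_nat mevalC hm subr_eq0 eqr_nat => /eqP ki.
by have := ltn_ord i; rewrite -ki ltnn.
Qed.

Lemma meval_nat v (j : nat) : (j%:R : CT).@[v] = j%:R.
Proof. by rewrite -mpolyC_nat mevalC. Qed.

(** The line h_1 = j is the graph of a constant. Starting at x = B + j ensures n x - j >= B. *)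
Lemma h1_line_dvd n B (j : nat) (p : CT) : (0 < n)%N ->
  (forall m : Z2, B%:Z <= n%:Z * m.1 - m.2 -> h1.@[point K m] = j%:R ->
     p.@[point K m] = 0) ->
  exists q, p = q * (h1 - j%:R).
Proof.
move=> n_gt0 p0; have [x Bx|q ->] := @graph_dvd j%:R%:P p (B + j).
  rewrite -[RHS](p0 (x%:Z, j%:Z)) /=; last by rewrite point_h1.
    by apply: meval_eq => i; rewrite /point hornerC; case: ifP.
  by nia.
by exists q; rewrite /embed_poly map_polyC hornerC /= mpolyC_nat.
Qed.

(** The line h_2 = j is the graph of n X - j. Its graph equation is the negative of h_2 - j, whence
    the sign of the quotient. *)
Lemma h2_line_dvd n B (j : nat) (p : CT) : (0 < n)%N ->
  (forall m : Z2, B%:Z <= m.2 -> (h2 n).@[point K m] = j%:R ->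
     p.@[point K m] = 0) ->
  exists q, p = q * (h2 n - j%:R).
Proof.
move=> n_gt0 p0; have [x Bx|q ->] := @graph_dvd ('X *+ n - j%:R%:P) p (B + j).
  rewrite -[RHS](p0 (x%:Z, n%:Z * x%:Z - j%:Z)) /=; first last.
  - by rewrite point_h2 /= opprB addrC subrK.
  - by nia.
  apply: meval_eq => i; rewrite /point; case: ifP => //= _.
  by rewrite hornerD hornerMn hornerX hornerN hornerC rmorphB rmorphM /= mulr_natl.
exists (- q); rewrite /embed_poly rmorphB rmorphMn /= map_polyX map_polyC.
rewrite hornerD hornerN hornerMn hornerX hornerC /= mpolyC_nat /h2.
by ring.
Qed.

End LineDivisibility.

(** * The graded pieces *)

Section Pieces.
Variable K : numFieldType.
Local Notation CT := {mpoly K[2]}.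

(** The number of factors of (a, N)!, whose index runs from 0 to N inclusive. *)
Definition fact_len (N : int) : nat := if N is Posz k then k.+1 else 0%N.

Lemma desc_factE (a : CT) N :
  desc_fact a N = \prod_(i < fact_len N) (a - (i : nat)%:R).
Proof. by case: N => [k|k] //=; rewrite big_ord0. Qed.

Lemma meval_desc_fact_eq0 (a : CT) N v (z : int) : a.@[v] = z%:~R ->
  ((desc_fact a N).@[v] == 0) = (0 <= z <= N).
Proof.
move=> az; rewrite desc_factE (big_morph _ (mevalM _) (meval1 _)).
rewrite prodf_seq_eq0; apply/hasP/idP => [[i _ /=]|zN].
  rewrite mevalB meval_nat az pmulrn subr_eq0 eqr_int => /eqP ->.
  by have := ltn_ord i; case: N {az} i => k i /=; lia.
have lt_z : (absz z < fact_len N)%N by case: N zN => k /=; lia.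
exists (Ordinal lt_z); rewrite ?mem_index_enum //= mevalB meval_nat az.
by rewrite pmulrn subr_eq0 eqr_int; lia.
Qed.

Lemma lines_ideal n (N1 N2 : int) (p : CT) (B : nat) : (0 < n)%N ->
  (forall m : Z2, B%:Z <= n%:Z * m.1 - m.2 -> 0 <= m.2 <= N1 ->
     p.@[point K m] = 0) ->
  (forall m : Z2, B%:Z <= m.2 -> 0 <= n%:Z * m.1 - m.2 <= N2 ->
     p.@[point K m] = 0) ->
  pideal (desc_fact h1 N1 * desc_fact (h2 n) N2) p.
Proof.
move=> n_gt0 p1 p2.
have lenP N (j : nat) : (j < fact_len N)%N = (0 <= j%:Z <= N) by case: N => k /=; lia.
have [||q pE] := @lines_dvd _ h1 [set m | B%:Z <= n%:Z * m.1 - m.2] (fact_len N1) p.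
- by move=> j q; exact: h1_line_dvd.
- move=> m j mB; rewrite lenP point_h1 => jN /eqP; rewrite pmulrn eqr_int => /eqP mj.
  by apply: p1 => //; rewrite mj.
rewrite -desc_factE in pE.
(* At height at least [B + fact_len N1] the factor (h_1, N1)! is nonzero, so the zeros of [p] on the
   lines h_2 = j pass to [q]. *)
have [||q' qE] := @lines_dvd _ (h2 n) [set m | (B + fact_len N1)%:Z <= m.2] (fact_len N2) q.
- by move=> j r; exact: h2_line_dvd.
- move=> m j mB; rewrite lenP point_h2 => jN /eqP; rewrite pmulrn eqr_int => /eqP mj.
  have /eqP : p.@[point K m] = 0.
    by apply: p2; [move: mB => /=; lia|rewrite mj].
  rewrite pE mevalM mulf_eq0 (meval_desc_fact_eq0 _ (point_h1 K m)) => /orP[/eqP//|].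
  by move: mB; case: (N1) => k /=; lia.
by exists q' => //; rewrite pE qE -desc_factE mulrAC -mulrA.
Qed.

Lemma pideal_meval_neq0 n (N1 N2 : int) (p : CT) (m : Z2) :
  pideal (desc_fact h1 N1 * desc_fact (h2 n) N2) p -> p.@[point K m] != 0 ->
  ~~ (0 <= m.2 <= N1) /\ ~~ (0 <= n%:Z * m.1 - m.2 <= N2).
Proof.
move=> [q _ <-]; rewrite !mevalM !mulf_eq0 !negb_or.
by rewrite (meval_desc_fact_eq0 _ (point_h1 K m)) (meval_desc_fact_eq0 _ (point_h2 K n m)) => /and3P[].
Qed.

(** p must vanish at the cone points m for which m + d is not interior, that is, h_i(m) <= - h_i(d)
    for some i. One formula serves all chambers, as the factorial is 1 when h_i(d) > 0. *)
Lemma piece_DJ n d : (1 < n)%N ->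
  piece (DJ K n) d =
  shift d (pideal (desc_fact h1 (- d.2) * desc_fact (h2 n) (- (n%:Z * d.1) + d.2))).
Proof.
move=> n1; have n0 := ltnW n1.
rewrite DJ_restricted // piece_restricted; congr shift.
case: d => d1 d2; apply/seteqP; split=> p /= pg; last first.
  move=> [m1 m2] pm [/= m2_ge0 m_ge0]; have [/= c1 c2] := pideal_meval_neq0 pg pm.
  by split; rewrite !Z2E /=; lia.
apply: (@lines_ideal _ _ _ _ 0) => // -[m1 m2] /= mB mN.
  have [//|/pg pm] := eqVneq p.@[point K (m1, m2)] 0.
  have [|+ _] := pm; first by split=> /=; lia.
  by rewrite Z2E /=; lia.
have [//|/pg pm] := eqVneq p.@[point K (m1, m2)] 0.
have [|_] := pm; first by split=> /=; lia.
by rewrite !Z2E /=; lia.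
Qed.

(* (h_i, -h_i(d))! enters the idealizer only when h_i(d) < 0; the value -1 gives
   the empty product. *)
Definition idealizer_exp (x : int) : int := if x < 0 then - x else -1.

(** Let h_i(d) < 0. Away from the other facet, preserving the cone forces zeros for 0 <= h_i(m) < -
    h_i(d), and preserving the interior for 0 < h_i(m) <= - h_i(d); the union is the range of (h_i,
    - h_i(d))!. *)
Lemma piece_IJ n d : (1 < n)%N ->
  piece (IJ K n) d =
  shift d (pideal (desc_fact h1 (idealizer_exp d.2) *
                   desc_fact (h2 n) (idealizer_exp (n%:Z * d.1 - d.2)))).
Proof.
move=> n1; have n0 := ltnW n1.
rewrite IJ_restricted // piece_restricted; congr shift.
case: d => d1 d2; apply/seteqP; split=> p /= pg; last first.
  move=> [m1 m2] pm; have [/= c1 c2] := pideal_meval_neq0 pg pm.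
  move: c1 c2; rewrite /idealizer_exp.
  case: (ltP d2) => ?; case: (ltP (_ - _)) => ? c1 c2; split=> -[/= ? ?];
    by split; rewrite !Z2E /=; lia.
(* The bound 1 keeps the other form positive, so a point is interior as soon as h_i(m) > 0. *)
apply: (@lines_ideal _ _ _ _ 1) => // -[m1 m2] /= mB; rewrite /idealizer_exp; case: ltP => d_lt0 mN;
  try lia.
  have [//|/pg pm] := eqVneq p.@[point K (m1, m2)] 0; case: pm => cm im.
  have [|+ _] := cm; first by split=> /=; lia.
  rewrite Z2E /= => ?; have m2_gt0 : 0 < m2 by lia.
  have [|+ _] := im; first by split=> /=; lia.
  by rewrite Z2E /=; lia.
have [//|/pg pm] := eqVneq p.@[point K (m1, m2)] 0; case: pm => cm im.
have [|_] := cm; first by split=> /=; lia.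
rewrite !Z2E /= => ?.
have [|_] := im; first by split=> /=; lia.
by rewrite !Z2E /=; lia.
Qed.

End Pieces.

(** * Quotients of pieces and the subgroups spanned by the facets *)

Section Quotients.
Variable K : comNzRingType.
Local Notation CT := {mpoly K[2]}.

Lemma desc_fact_neg (a : CT) N : N < 0 -> desc_fact a N = 1.
Proof. by case: N. Qed.

Lemma desc_fact0 (a : CT) : desc_fact a 0 = a.
Proof. by rewrite /= big_ord1 subr0. Qed.

Lemma idealizer_fact_ge0 (a : CT) x : 0 <= x -> desc_fact a (idealizer_exp x) = 1.
Proof. by rewrite /idealizer_exp ltNge => ->. Qed.

(** For x > 0 both products are empty. At x = 0 they are 1 and a, and this discrepancy is the source
    of the nonzero pieces of the quotient. *)
Lemma idealizer_fact_neq0 (a : CT) x : x != 0 ->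
  desc_fact a (idealizer_exp x) = desc_fact a (- x).
Proof.
move=> x0; rewrite /idealizer_exp; case: ifP => // x_ge0.
by rewrite !desc_fact_neg //; lia.
Qed.

Lemma pideal1 : pideal (1 : CT) = setT.
Proof. by apply/seteqP; split=> p // _; exists p => //; rewrite mulr1. Qed.

Lemma quotient_pideal_self d (g : CT) :
  quotient (shift d (pideal g)) (shift d (pideal g)) = [set shift d (pideal g)].
Proof.
have shiftE p q (f : laurent K) :
    mon K d * op_of_poly (p + q) f = mon K d * op_of_poly p f + mon K d * op_of_poly q f.
  by apply: coefP => e; rewrite coefD !coef_shift mevalD mulrDl.
have coset delta : shift d (pideal g) delta ->
    [set delta + nu | nu in shift d (pideal g)] = shift d (pideal g).
  move=> [_ [a _ <-] ->]; apply/seteqP; split.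
    move=> _ [_ [_ [b _ <-] ->] <-]; exists (a * g + b * g).
      by exists (a + b) => //; rewrite mulrDl.
    by apply/funext => f; rewrite shiftE.
  move=> _ [_ [b _ <-] ->]; exists (fun f => mon K d * op_of_poly ((b - a) * g) f).
    by exists ((b - a) * g) => //; exists (b - a).
  by apply/funext => f; rewrite addrfctE -shiftE -mulrDl addrC subrK.
apply/seteqP; split=> X; first by move=> [delta Md ->]; exact: coset.
move=> ->; exists (fun f => mon K d * op_of_poly g f).
  by exists g => //; exists 1; rewrite ?mul1r.
by rewrite coset //; exists g => //; exists 1; rewrite ?mul1r.
Qed.

End Quotients.

Lemma Zspan_sigma1 : Zspan sigma1 = [set d | d.2 = 0].
Proof.
rewrite /Zspan; apply/seteqP; split.
  apply: smallest_sub => [|_ [x ->] //]; split=> // x y /= x0 y0.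
  by change ((x - y).2 = 0); rewrite !Z2E x0 y0 subrr.
move=> [[x|x] y] /= -> H [[H0 HB] sH]; first by apply: sH; exists x.
have -> : (Negz x, 0) = 0 - (x.+1%:Z, 0) :> Z2 by apply: Z2_eq; rewrite Z2E //= NegzE add0r.
by apply: HB => //; apply: sH; exists x.+1.
Qed.

Lemma Zspan_sigma2 n : Zspan (sigma2 n) = [set d | d.2 = n%:Z * d.1].
Proof.
rewrite /Zspan; apply/seteqP; split.
  apply: smallest_sub => [|_ [x ->] //]; split=> [|x y /= x0 y0]; first by rewrite /= mulr0.
  by change ((x - y).2 = n%:Z * (x - y).1); rewrite !Z2E x0 y0 mulrBr.
move=> [[x|x] y] /= -> H [[H0 HB] sH]; first by apply: sH; exists x.
have -> : (Negz x, n%:Z * Negz x) = 0 - (x.+1%:Z, n%:Z * x.+1%:Z) :> Z2.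
  by apply: Z2_eq; rewrite !Z2E ?NegzE /= ?mulrN add0r.
by apply: HB => //; apply: sH; exists x.+1.
Qed.

(** * The case distinction on the degree *)

Section Decomposition.
Variables (K : numFieldType) (n : nat).
Hypothesis hn : (2 <= n)%N.

Let n_gt0 : (0 < n)%N := ltnW hn.

Let pI d := @piece_IJ K n d hn.
Let pD d := @piece_DJ K n d hn.

Lemma h2_opp (d : Z2) : - (n%:Z * d.1) + d.2 = - (n%:Z * d.1 - d.2).
Proof. by rewrite opprB addrC. Qed.

Lemma IJ_pieces : forall d : Z2,
      [/\ d \in NA n -> piece (IJ K n) d = shift d setT,
          d \in C4 n -> piece (IJ K n) d = shift d (pideal (desc_fact h1 (- d.2))),
          d \in C2 n ->
            piece (IJ K n) d = shift d (pideal (desc_fact (h2 n) (- (n%:Z * d.1) + d.2)))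
        & d \in C3 n ->
            piece (IJ K n) d =
              shift d (pideal (desc_fact h1 (- d.2) *
                               desc_fact (h2 n) (- (n%:Z * d.1) + d.2)))].
Proof.
move=> d; split; rewrite inE.
- rewrite NA_cone // => -[d2 dn].
  by rewrite pI !idealizer_fact_ge0 // mulr1 pideal1.
- move=> [d2 dn]; rewrite pI (idealizer_fact_ge0 _ dn) mulr1.
  by rewrite idealizer_fact_neq0 // lt_eqF.
- move=> [d2 dn]; rewrite pI (idealizer_fact_ge0 _ d2) mul1r.
  by rewrite idealizer_fact_neq0 ?lt_eqF // h2_opp.
- move=> [d2 dn]; rewrite pI.
  by rewrite !idealizer_fact_neq0 ?lt_eqF // h2_opp.
Qed.

Lemma DJ_pieces : forall d : Z2,
      [/\ mon K d \in J K n -> piece (DJ K n) d = shift d setT,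
          d \in (C4 n `\` opp_set (sigma2 n)) `|` (sigma1 `\ 0) ->
            piece (DJ K n) d = shift d (pideal (desc_fact h1 (- d.2))),
          d \in (C2 n `\` opp_set sigma1) `|` (sigma2 n `\ 0) ->
            piece (DJ K n) d = shift d (pideal (desc_fact (h2 n) (- (n%:Z * d.1) + d.2)))
        & d \in C3 n `|` opp_set sigma1 `|` opp_set (sigma2 n) ->
            piece (DJ K n) d =
              shift d (pideal (desc_fact h1 (- d.2) *
                               desc_fact (h2 n) (- (n%:Z * d.1) + d.2)))].
Proof.
move=> d; split; rewrite inE.
- rewrite J_supported // => /(_ d); rewrite coef_mon eqxx oner_neq0 => /(_ isT)[d2 dn].
  by rewrite pD !desc_fact_neg ?mulr1 ?pideal1 ?h2_opp ?oppr_lt0.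
(* Here h_2(d) > 0: a point of C4 with h_2 = 0 lies in -sigma_2, and on sigma_1 only the origin has
   h_2 = 0. *)
- move=> dP; rewrite pD [desc_fact (h2 n) _]desc_fact_neg ?mulr1 //.
  case: d dP => d1 d2 [[[/= d2_lt0 dn] ds]|[[x [-> ->]] dx]] /=; last first.
    by case: x dx => [[]|x _] //=; nia.
  have : n%:Z * d1 - d2 != 0; last by lia.
  apply/eqP => /eqP; rewrite subr_eq0 => /eqP dE; apply: ds.
  exists (- d1, - d2); last by apply: Z2_eq; rewrite Z2E /= opprK.
  exists (absz d1); apply: Z2_eq => /=; nia.
(* Here h_1(d) > 0, by the symmetric argument. *)
- move=> dP; rewrite pD [desc_fact h1 _]desc_fact_neg ?mul1r //.
  case: d dP => d1 d2 [[[/= d2_ge0 dn] ds]|[[x [-> ->]] dx]] /=; last first.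
    by case: x dx => [[]|x _] //=; [rewrite mulr0|nia].
  have : d2 != 0; last by lia.
  apply/eqP => d20; apply: ds; exists (- d1, 0).
    by exists (absz d1); apply: Z2_eq => /=; nia.
  by apply: Z2_eq; rewrite Z2E /= ?opprK // d20 oppr0.
- by rewrite pD.
Qed.

Lemma IJ_DJ_quotient_pieces : forall d : Z2,
      [/\ d \notin Zspan sigma1 `|` Zspan (sigma2 n) ->
            quotient_piece (IJ K n) (DJ K n) d = [set piece (DJ K n) d],
          d = 0 ->
            quotient_piece (IJ K n) (DJ K n) d =
              quotient (shift d setT) (shift d (pideal (h1 * h2 n))),
          d \in Zspan sigma1 `\ 0 ->
            quotient_piece (IJ K n) (DJ K n) d =
              quotient (shift (d.1, 0) (pideal (desc_fact (h2 n) (- (n%:Z * d.1)))))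
                       (shift (d.1, 0)
                          (pideal (h1 * desc_fact (h2 n) (- (n%:Z * d.1)))))
        & d \in Zspan (sigma2 n) `\ 0 ->
            quotient_piece (IJ K n) (DJ K n) d =
              quotient (shift d (pideal (desc_fact h1 (- d.2))))
                       (shift d (pideal (h2 n * desc_fact h1 (- d.2))))].
Proof.
move=> d; split; rewrite ?inE ?Zspan_sigma1 ?Zspan_sigma2 /quotient_piece.
- rewrite notin_setE => /not_orP[/eqP d2 /eqP dn].
  rewrite pI !idealizer_fact_neq0 //; last by rewrite subr_eq0 eq_sym.
  by rewrite -h2_opp pD quotient_pideal_self.
- move=> ->; rewrite pI pD (_ : (0 : Z2).1 = 0) // (_ : (0 : Z2).2 = 0) //.
  by rewrite !mulr0 subrr oppr0 !idealizer_fact_ge0 // mulr1 pideal1 !desc_fact0.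
- case: d => d1 d2 [/= d2_eq0 d0]; rewrite pI pD /= d2_eq0.
  have nd1 : n%:Z * d1 != 0.
    rewrite mulf_neq0 ?eqz_nat -?lt0n //.
    by apply/eqP => d10; apply: d0; rewrite d10 d2_eq0.
  (* As h_1(d) = 0, D(R_A, J) carries the factor (h_1, 0)! = h_1 while the idealizer carries 1; the
     factors in h_2 agree because h_2(d) is nonzero. *)
  rewrite subr0 addr0 oppr0 desc_fact0 idealizer_fact_ge0 // mul1r.
  by rewrite idealizer_fact_neq0.
- case: d => d1 d2 [/= d2E d0]; rewrite pI pD /= d2E.
  have nd1 : n%:Z * d1 != 0.
    rewrite mulf_neq0 ?eqz_nat -?lt0n //.
    by apply/eqP => d10; apply: d0; rewrite d2E d10 mulr0.
  rewrite subrr addNr desc_fact0 [desc_fact (h2 n) _]idealizer_fact_ge0 // mulr1.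
  by rewrite idealizer_fact_neq0 // [_ * h2 n]mulrC.
Qed.

End Decomposition.

Theorem mainTheorem2 (R : realType) (n : nat) (hn : (2 <= n)%N) :
  [/\ Z2graded (IJ (CC R) n) /\ Z2graded (DJ (CC R) n),
      forall d : Z2,
      [/\ d \in NA n -> piece (IJ (CC R) n) d = shift d setT,
          d \in C4 n -> piece (IJ (CC R) n) d = shift d (pideal (desc_fact h1 (- d.2))),
          d \in C2 n ->
            piece (IJ (CC R) n) d = shift d (pideal (desc_fact (h2 n) (- (n%:Z * d.1) + d.2)))
        & d \in C3 n ->
            piece (IJ (CC R) n) d =
              shift d (pideal (desc_fact h1 (- d.2) *
                               desc_fact (h2 n) (- (n%:Z * d.1) + d.2)))],
      forall d : Z2,
      [/\ mon (CC R) d \in J (CC R) n -> piece (DJ (CC R) n) d = shift d setT,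
          d \in (C4 n `\` opp_set (sigma2 n)) `|` (sigma1 `\ 0) ->
            piece (DJ (CC R) n) d = shift d (pideal (desc_fact h1 (- d.2))),
          d \in (C2 n `\` opp_set sigma1) `|` (sigma2 n `\ 0) ->
            piece (DJ (CC R) n) d = shift d (pideal (desc_fact (h2 n) (- (n%:Z * d.1) + d.2)))
        & d \in C3 n `|` opp_set sigma1 `|` opp_set (sigma2 n) ->
            piece (DJ (CC R) n) d =
              shift d (pideal (desc_fact h1 (- d.2) *
                               desc_fact (h2 n) (- (n%:Z * d.1) + d.2)))]
    & forall d : Z2,
      [/\ d \notin Zspan sigma1 `|` Zspan (sigma2 n) ->
            quotient_piece (IJ (CC R) n) (DJ (CC R) n) d = [set piece (DJ (CC R) n) d],
          d = 0 ->
            quotient_piece (IJ (CC R) n) (DJ (CC R) n) d =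
              quotient (shift d setT) (shift d (pideal (h1 * h2 n))),
          d \in Zspan sigma1 `\ 0 ->
            quotient_piece (IJ (CC R) n) (DJ (CC R) n) d =
              quotient (shift (d.1, 0) (pideal (desc_fact (h2 n) (- (n%:Z * d.1)))))
                       (shift (d.1, 0)
                          (pideal (h1 * desc_fact (h2 n) (- (n%:Z * d.1)))))
        & d \in Zspan (sigma2 n) `\ 0 ->
            quotient_piece (IJ (CC R) n) (DJ (CC R) n) d =
              quotient (shift d (pideal (desc_fact h1 (- d.2))))
                       (shift d (pideal (h2 n * desc_fact h1 (- d.2))))]].
Proof.
split.
- by rewrite IJ_restricted // DJ_restricted //; split; exact: restricted_Z2graded.
- exact: (@IJ_pieces (CC R) n hn).
- exact: (@DJ_pieces (CC R) n hn).
- exact: (@IJ_DJ_quotient_pieces (CC R) n hn).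
Qed.
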